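(* Let $n\in\mathbb{N}$, $P\subseteq[n]\times[n]$, and $V=\{\sum_{(i,j)\in P}\omega_{ij}E_{ij}:\omega_{ij}\in\mathbb{R}\}\subseteq M_n(\mathbb{R})$. Let $\psi:V\to\mathbb{R}$ be a convex and positively homogeneous function. Suppose that $f:V\to\mathbb{R}$ is one of the following functions: (i) a concave and positively homogeneous function; (ii) for given real numbers $\alpha_i$ ($i\in[n^2]$), $f(A)=\sum_{i\in[n^2]}\alpha_i A_{\downarrow i}$; (iii) for given real numbers $\alpha_{ij}$ ($i,j\in[n]$), $f(A)=\sum_{j\in[n]}\sum_{i\in[n]}\alpha_{ij}\,\boldsymbol{r}^{i}_{\downarrow j}$, where $\boldsymbol{r}^{i}$ is the $i$-th row of $A$. Then the following statements are equivalent: (1) For every $A\in V$, $\psi(A)\le f(A)$. (2) For every $A\in V_{\{0,\pm1\}}$, $\psi(A)\le f(A)$.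
   Context: $[n]=\{1,\ldots,n\}$. $M_n(\mathbb{R})$ is the set of real $n\times n$ matrices and $E_{ij}=\boldsymbol{e}_i\boldsymbol{e}_j^T$ is the $n\times n$ matrix with a $1$ in position $(i,j)$ and $0$ elsewhere. For a vector $\boldsymbol{x}\in\mathbb{R}^n$, $\boldsymbol{x}_{\downarrow1}\ge\cdots\ge\boldsymbol{x}_{\downarrow n}$ are its coordinates in decreasing order. For an $n\times n$ matrix $A$, $A_{\downarrow1}\ge\cdots\ge A_{\downarrow n^2}$ are all $n^2$ entries of $A$ in decreasing order. A function $g$ is positively homogeneous if $g(\alpha v)=\alpha g(v)$ for all real $\alpha>0$ and all $v$ in its domain. $V_{\{0,\pm1\}}$ is the set of matrices in $V$ all of whose entries lie in $\{-1,0,1\}$. *)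

(* Defs.v *)
From mathcomp Require Import all_boot all_order all_algebra.
From mathcomp Require Import boolp classical_sets interval_inference reals convex.

Set Implicit Arguments.
Unset Strict Implicit.
Unset Printing Implicit Defensive.

Import Order.TTheory GRing.Theory Num.Theory.

Local Open Scope classical_set_scope.
Local Open Scope ring_scope.
Local Open Scope convex_scope.

(* A real function on V is represented by a total function on 'M[R]_n of which
   only the values on V are ever used. *)

Definition pattern_space (R : realType) (n : nat) (P : {set 'I_n * 'I_n}) :
    set 'M[R]_n :=
  [set A | exists w : 'I_n -> 'I_n -> R,
     A = \sum_(p in P) w p.1 p.2 *: delta_mx p.1 p.2].

Definition sign_part (R : realType) (n : nat) (V : set 'M[R]_n) :
    set 'M[R]_n :=
  [set A | V A /\ forall i j, [\/ A i j = -1, A i j = 0 | A i j = 1]].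

Definition pos_homogeneous (R : realType) (E : lmodType R) (D : set E)
    (g : E -> R) : Prop :=
  forall (a : R) (v : E), 0 < a -> D v -> g (a *: v) = a * g v.

(* Counterpart of convex_function, with the inequality reversed. *)
Definition concave_function (R : realType) (E : lmodType R)
    (E' := convex_lmodType E) (D : set E') (f : E' -> R^o) : Prop :=
  forall (t : {i01 R}),
    {in D &, forall x y : E', (f x <| t |> f y <= f (x <| t |> y))%R}.

(* Indices start at 0: vec_down x k is the (k+1)-st largest coordinate of x,
   counted with multiplicity; likewise for mx_down. *)
Definition vec_down (R : realType) (n : nat) (x : 'rV[R]_n) (k : 'I_n) : R :=
  (sort (fun a b : R => b <= a) [seq x 0 j | j <- enum 'I_n])`_k.

Definition mx_down (R : realType) (n : nat) (A : 'M[R]_n) (k : 'I_(n ^ 2)) : R :=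
  (sort (fun a b : R => b <= a)
     [seq A i j | i <- enum 'I_n, j <- enum 'I_n])`_k.

(* Main.v *)
Require Import Defs.
From mathcomp Require Import all_boot all_order all_algebra.
From mathcomp Require Import boolp classical_sets interval_inference reals convex.
From mathcomp Require Import ring lra.

Set Implicit Arguments.
Unset Strict Implicit.
Unset Printing Implicit Defensive.

Import Order.TTheory GRing.Theory Num.Theory.

Local Open Scope classical_set_scope.
Local Open Scope ring_scope.

(** If c is the least absolute value of a nonzero entry of A, then A splits as
    c S + A' where S is the entrywise sign of A, and both x |-> sg x and
    x |-> x - c sg x are nondecreasing on the entries of A. Hence the decreasing
    rearrangement commutes with the splitting, so the functions (ii) and (iii)
    satisfy c f(S) + f(A') = f(A), while in case (i) superadditivity gives <=.
    Since psi is subadditive, the inequality for S and A' yields it for A, and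
    A' has fewer nonzero entries than A. *)

(** Both sides are decreasing rearrangements of the same multiset, hence equal by antisymmetry of
    the order. Monotonicity is asked on [s] only, because [x - c * sg x] jumps down at 0 and is not
    monotone on the whole line. *)
Lemma sort_decreasing_map (R : realDomainType) (g : R -> R) (s : seq R) :
    {in s &, {homo g : x y / x <= y}} ->
  sort (fun a b => b <= a) (map g s) = map g (sort (fun a b => b <= a) s).
Proof.
move=> g_homo; have ge_total : total (fun a b : R => b <= a).
  by move=> x y; apply: le_total.
apply: (@sorted_eq _ (fun a b : R => b <= a)).
- by move=> x y z /[swap]; apply: le_trans.
- by move=> x y; rewrite andbC => /le_anti.
- exact: sort_sorted.
- apply: (@homo_sorted_in _ _ (mem s) g (fun a b => b <= a)).
  + by move=> x y xs ys; apply: g_homo.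
  + by apply/allP => x; rewrite mem_sort.
  + exact: sort_sorted.
- by rewrite perm_sort perm_map // perm_sym perm_sort.
Qed.

Lemma nth_sort_decreasing_split (R : realDomainType) (c : R) (g h : R -> R)
    (s : seq R) (k : nat) :
    {in s &, {homo g : x y / x <= y}} -> {in s &, {homo h : x y / x <= y}} ->
    (forall x, x = c * g x + h x) -> (k < size s)%N ->
  (sort (fun a b => b <= a) s)`_k =
    c * (sort (fun a b => b <= a) (map g s))`_k
    + (sort (fun a b => b <= a) (map h s))`_k.
Proof.
move=> g_homo h_homo ghE ks.
by rewrite !sort_decreasing_map // !(nth_map 0) ?size_sort.
Qed.

Lemma vec_down_split (R : realType) (n : nat) (c : R) (g h : R -> R)
    (x : 'rV[R]_n) (k : 'I_n) :
    {in [seq x 0 j | j <- enum 'I_n] &, {homo g : a b / a <= b}} ->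
    {in [seq x 0 j | j <- enum 'I_n] &, {homo h : a b / a <= b}} ->
    (forall a, a = c * g a + h a) ->
  vec_down x k = c * vec_down (map_mx g x) k + vec_down (map_mx h x) k.
Proof.
move=> g_homo h_homo ghE.
rewrite /vec_down (nth_sort_decreasing_split g_homo h_homo ghE); last first.
  by rewrite size_map size_enum_ord.
rewrite -!map_comp; congr (_ * (sort _ _)`_k + (sort _ _)`_k);
  by apply: eq_map => j /=; rewrite mxE.
Qed.

Lemma mx_down_split (R : realType) (n : nat) (c : R) (g h : R -> R)
    (A : 'M[R]_n) (k : 'I_(n ^ 2)) :
    {in [seq A i j | i <- enum 'I_n, j <- enum 'I_n] &,
      {homo g : a b / a <= b}} ->
    {in [seq A i j | i <- enum 'I_n, j <- enum 'I_n] &,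
      {homo h : a b / a <= b}} ->
    (forall a, a = c * g a + h a) ->
  mx_down A k = c * mx_down (map_mx g A) k + mx_down (map_mx h A) k.
Proof.
move=> g_homo h_homo ghE.
rewrite /mx_down (nth_sort_decreasing_split g_homo h_homo ghE); last first.
  by rewrite size_allpairs size_enum_ord mulnn.
rewrite !map_allpairs; congr (_ * (sort _ _)`_k + (sort _ _)`_k);
  by apply: eq_allpairs => i j /=; rewrite mxE.
Qed.

(** In this form, closure of the space under scaling and under entrywise maps fixing 0 is
    immediate. *)
Lemma pattern_spaceP (R : realType) (n : nat) (P : {set 'I_n * 'I_n})
    (A : 'M[R]_n) :
  pattern_space P A <-> (forall i j, (i, j) \notin P -> A i j = 0).
Proof.
have sumE (w : 'I_n -> 'I_n -> R) i j :
    (\sum_(p in P) w p.1 p.2 *: delta_mx p.1 p.2 : 'M[R]_n) i j =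
    if (i, j) \in P then w i j else 0.
  have term0 p : p != (i, j) -> (w p.1 p.2 *: delta_mx p.1 p.2 : 'M[R]_n) i j = 0.
    case: p => a b; rewrite !mxE xpair_eqE /= [a == i]eq_sym [b == j]eq_sym.
    by move=> /negPf ->; rewrite mulr0.
  rewrite summxE; case: ifP => ijP.
    rewrite (bigD1 (i, j)) //= big1 => [|p /andP[_ /term0 //]].
    by rewrite !mxE !eqxx mulr1 addr0.
  rewrite big1 // => p pP; apply: term0.
  by apply: contraTneq pP => ->; rewrite ijP.
split=> [[w ->] i j ijP|A0]; first by rewrite sumE (negPf ijP).
exists (fun i j => A i j); apply/matrixP => i j; rewrite sumE.
by case: ifPn => // /A0.
Qed.

Lemma sign_peel (R : realType) (n : nat) (A : 'M[R]_n) : A != 0 ->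
  exists c : R, [/\ 0 < c,
    {in [seq A i j | i <- enum 'I_n, j <- enum 'I_n] &,
      {homo (fun x => x - c * Num.sg x) : x y / x <= y}} &
    (#|[pred p : 'I_n * 'I_n |
        (map_mx (fun x => x - c * Num.sg x) A p.1 p.2 != 0)%R]| <
      #|[pred p : 'I_n * 'I_n | (A p.1 p.2 != 0)%R]|)%N].
Proof.
move=> A0; have [[i0 j0] Aij0] : exists p, A p.1 p.2 != 0.
  apply/existsP; apply: contraR A0 => /existsPn A0; apply/eqP/matrixP => i j.
  by rewrite mxE; apply/eqP; rewrite -[_ == _]negbK (A0 (i, j)).
pose F (p : 'I_n * 'I_n) := `|A p.1 p.2|.
(* The constant [c] is the least absolute value of a nonzero entry, so no entry lies in (-c, 0) or
   (0, c), where monotonicity would fail. *)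
have [[i1 j1] /= A1 Fmin] := @arg_minP _ _ _ (i0, j0)
  (fun p : 'I_n * 'I_n => A p.1 p.2 != 0) F Aij0.
set c := F (i1, j1) in Fmin.
have c0 : 0 < c by rewrite normr_gt0.
have entry x : x \in [seq A i j | i <- enum 'I_n, j <- enum 'I_n] ->
    [\/ x <= - c, x = 0 | c <= x].
  case/allpairsP => -[i j] [_ _ /= ->].
  have [->|Aij] := eqVneq (A i j) 0; first by constructor 2.
  have := Fmin (i, j) Aij; rewrite /F /= ler_normr => /orP[cx|cx].
    by constructor 3.
  by constructor 1; rewrite lerNr.
exists c; split=> //.
- move=> x y /entry xE /entry yE; case: (sgrP x) => x0; case: (sgrP y) => y0;
    case: xE => xE; case: yE => yE; lra.
(* Zero entries stay zero, and the minimizing entry [(i1, j1)] becomes zero. *)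
- apply/proper_card/properP; split.
    apply/fintype.subsetP => p; rewrite !inE mxE; apply: contra_neq => ->.
    by rewrite sgr0 mulr0 subr0.
  exists (i1, j1); rewrite !inE ?mxE //= negbK /c /F /=.
  by rewrite mulrC mulr_sg_norm subrr.
Qed.

(** Write x + y as the midpoint of 2x and 2y, which lie in the cone [D]; homogeneity then cancels
    the factors 2 and 1/2. *)
Lemma convex_homogeneous_subadditive (R : realType) (E : lmodType R)
    (D : set E) (g : E -> R) :
    convex_function D g -> pos_homogeneous D g ->
    (forall a v, 0 < a -> D v -> D (a *: v)) ->
  forall x y, D x -> D y -> g (x + y) <= g x + g y.
Proof.
move=> g_convex g_hom D_cone x y Dx Dy.
have D2 z : D z -> (2 *: z) \in D by move=> Dz; rewrite inE; apply: D_cone.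
have half_le : g (2^-1 *: (2 *: x) + (1 - 2^-1) *: (2 *: y)) <=
    2^-1 * g (2 *: x) + (1 - 2^-1) * g (2 *: y).
  have half0 : 0 <= 2^-1 :> R by lra.
  have half1 : 2^-1 <= 1 :> R by lra.
  exact: (g_convex (Itv01 half0 half1) _ _ (D2 x Dx) (D2 y Dy)).
have halfC : 1 - 2^-1 = 2^-1 :> R by lra.
by move: half_le; rewrite halfC !g_hom //
  !scalerA !mulrA mulVf // !scale1r !mul1r.
Qed.

Lemma concave_homogeneous_superadditive (R : realType) (E : lmodType R)
    (D : set E) (g : E -> R) :
    concave_function D g -> pos_homogeneous D g ->
    (forall a v, 0 < a -> D v -> D (a *: v)) ->
  forall x y, D x -> D y -> g x + g y <= g (x + y).
Proof.
move=> g_concave g_hom D_cone x y Dx Dy.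
rewrite -lerN2 opprD.
apply: (@convex_homogeneous_subadditive R E D (fun z => - g z)) => //.
- by move=> t u v uD vD; rewrite /= -convN lerN2; apply: g_concave.
- by move=> a v a0 Dv; rewrite g_hom // mulrN.
Qed.

Theorem theorem2p4 (R : realType) (n : nat) (P : {set 'I_n * 'I_n})
    (V : set 'M[R]_n := pattern_space P) (psi f : 'M[R]_n -> R)
    (psi_convex : convex_function V psi)
    (psi_homogeneous : pos_homogeneous V psi)
    (f_cases :
      [\/ concave_function V f /\ pos_homogeneous V f,
          exists alpha : 'I_(n ^ 2) -> R, forall A, V A ->
            f A = \sum_(i < n ^ 2) alpha i * mx_down A i
        | exists alpha : 'I_n -> 'I_n -> R, forall A, V A ->
            f A = \sum_(j < n) \sum_(i < n) alpha i j * vec_down (row i A) j]) :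
  (forall A, V A -> psi A <= f A) <->
  (forall A, sign_part V A -> psi A <= f A).
Proof.
split=> [psi_le A [VA _]|psi_le_sign A]; first exact: psi_le.
have VZ a B : 0 < a -> V B -> V (a *: B).
  move=> _ /pattern_spaceP B0; apply/pattern_spaceP => i j ijP.
  by rewrite mxE B0 // mulr0.
have Vmap g B : g 0 = 0 -> V B -> V (map_mx g B).
  move=> g0 /pattern_spaceP B0; apply/pattern_spaceP => i j ijP.
  by rewrite mxE B0.
(* Induction on a strict upper bound for the number of nonzero entries, with [A] generalized. *)
elim: {A}_.+1 {-2}A
  (ltnSn #|[pred p : 'I_n * 'I_n | (A p.1 p.2 != 0)%R]|) => // m IH A.
rewrite ltnS => Am VA.
(* The zero matrix has no least nonzero entry to peel off, but it is itself a sign matrix. *)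
have [->|/sign_peel[c [c0 h_homo A'lt]]] := eqVneq A 0.
  apply: psi_le_sign; split=> [|i j]; last by rewrite mxE; constructor 2.
  by apply/pattern_spaceP => i j _; rewrite mxE.
set h := fun x : R => x - c * Num.sg x in h_homo A'lt.
pose S := map_mx Num.sg A; pose A' := map_mx h A.
have VS : V S by apply: Vmap => //; rewrite sgr0.
have VA' : V A' by apply: Vmap => //; rewrite /h sgr0 mulr0 subr0.
have sg_homo : {homo (Num.sg : R -> R) : x y / x <= y}.
  by move=> x y xy; case: (sgrP x) => x0; case: (sgrP y) => y0; lra.
have splitE x : x = c * Num.sg x + h x by rewrite /h; ring.
have AE : A = c *: S + A' by apply/matrixP => i j; rewrite !mxE.
have psi_S : psi S <= f S.
  apply: psi_le_sign; split=> // i j; rewrite mxE.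
  by case: sgrP; [constructor 2|constructor 3|constructor 1].
have psi_A' : psi A' <= f A' by apply: IH => //; apply: leq_trans Am.
have psi_A : psi A <= c * psi S + psi A'.
  rewrite {1}AE -psi_homogeneous //.
  apply: (convex_homogeneous_subadditive psi_convex) => //; exact: VZ.
apply: (le_trans psi_A).
apply: (@le_trans _ _ (c * f S + f A')); first by rewrite lerD // ler_pM2l.
case: f_cases => [[f_concave f_hom]|[alpha fE]|[alpha fE]].
- rewrite AE -f_hom //.
  apply: (concave_homogeneous_superadditive f_concave) => //; exact: VZ.
(* The weights [alpha] may have any sign, so a termwise inequality would not do; the splitting of
   the sorted entries is exact and gives equality. *)
- rewrite !fE // mulr_sumr -big_split /= le_eqVlt; apply/orP; left; apply/eqP.
  apply: eq_bigr => i _.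
  rewrite (@mx_down_split _ _ c Num.sg h A i) //; first ring.
  by move=> x y _ _; apply: sg_homo.
- rewrite !fE // mulr_sumr -big_split /= le_eqVlt; apply/orP; left; apply/eqP.
  apply: eq_bigr => j _; rewrite mulr_sumr -big_split /=.
  apply: eq_bigr => i _; rewrite -!map_row.
  rewrite (@vec_down_split _ _ c Num.sg h (row i A) j) //; first ring.
  + by move=> x y _ _; apply: sg_homo.
  (* Entries of a row are entries of [A], so the one constant [c] serves all rows at once. *)
  + move=> x y /mapP[k _ ->] /mapP[l _ ->]; rewrite !mxE.
    by apply: h_homo; apply: allpairs_f; rewrite mem_enum.
Qed.
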